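(* Let $q\ge2$ be an integer and let $(p_n)_{n\ge0}$ be defined by $p_0=\dots=p_{q-2}=0$, $p_{q-1}=1$ and $p_{n+q}=p_{n+1}+p_n$ for $n\ge0$. Then $$p_n=c_{n-q+1}(q-1\text{ or }q)\quad (n\ge q),$$ and, for all $n\ge1$, $$p_n=c_n\big(q-1\ (\mathrm{mod}\ q)\big),\qquad p_n=c_{n+1}\big(1\ (\mathrm{mod}\ q-1)\text{ and }\ne1\big).$$
   Context: A composition of $m$ with parts in a set $S$ of positive integers is an ordered tuple of elements of $S$ summing to $m$; $c_m(S)$ denotes their number. Here $c_m(q-1\text{ or }q)$ counts compositions with parts in $\{q-1,q\}$; $c_m(q-1\ (\mathrm{mod}\ q))$ counts those with all parts congruent to $q-1$ modulo $q$; $c_m(1\ (\mathrm{mod}\ q-1)\text{ and }\ne1)$ counts those with all parts congruent to $1$ modulo $q-1$ and different from $1$ (for $q=2$: all parts $\ge2$). *)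

(* Defs.v *)
From mathcomp Require Import all_boot.

Set Implicit Arguments.
Unset Strict Implicit.
Unset Printing Implicit Defensive.

Definition is_composition (m : nat) (S : {pred nat}) (s : seq nat) : bool :=
  all (fun k => (0 < k) && (k \in S)) s && (sumn s == m).

(* A composition of m has at most m parts, each at most m, so the compositions
   of m are counted inside the finite type of sequences of length at most m
   over {0, ..., m}; see count_compositionsP. *)
Definition count_compositions (m : nat) (S : {pred nat}) : nat :=
  #|[set c : m.-bseq 'I_m.+1 | is_composition m S [seq val i | i <- c]]|.

Lemma count_compositionsP (m : nat) (S : {pred nat}) :
  exists l : seq (seq nat),
    [/\ uniq l, (forall s, (s \in l) = is_composition m S s)
      & size l = count_compositions m S].
Proof.
pose A := [set c : m.-bseq 'I_m.+1 | is_composition m S [seq val i | i <- c]].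
pose f (c : m.-bseq 'I_m.+1) := [seq val i | i <- c].
have f_inj : injective f by move=> c d /(inj_map val_inj) /val_inj.
exists [seq f c | c <- enum A]; split.
- by rewrite map_inj_uniq ?enum_uniq.
- move=> s; apply/mapP/idP => [[c] | Hs].
    by rewrite mem_enum inE => Hc ->.
  have /andP[/allP Spos /eqP Ssum] := Hs.
  have le_size : size s <= m.
    rewrite -Ssum; elim: s Spos {Hs Ssum} => //= k s IHs Spos.
    have /andP[k_gt0 _] := Spos k (mem_head k s).
    rewrite -add1n leq_add // IHs // => j js.
    by apply: Spos; rewrite inE js orbT.
  have le_part k : k \in s -> k < m.+1.
    rewrite ltnS -Ssum; elim: s {Hs Spos Ssum le_size} => //= j s IHs.
    rewrite inE => /predU1P[-> | /IHs le_ks]; first exact: leq_addr.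
    exact: leq_trans le_ks (leq_addl _ _).
  have sz : size [seq inord k : 'I_m.+1 | k <- s] <= m by rewrite size_map.
  have fE : f (Bseq sz) = s.
    rewrite /f /= -map_comp -[RHS]map_id; apply/eq_in_map => k /le_part lek /=.
    by rewrite inordK.
  by exists (Bseq sz); rewrite ?fE // mem_enum inE -/(f _) fE.
- by rewrite size_map -cardE.
Qed.

(* Main.v *)
Require Import Defs.
From mathcomp Require Import all_boot zify.

(** All three families of compositions are counted by splitting off the first
    part.  When the parts form an arithmetic progression a, a + d, a + 2d, ...,
    either the first part is a or d can be subtracted from it, which collapses
    the first-part recurrence to c_m = c_{m-a} + c_{m-d}, where c_{m-d} is
    present only if m > d (the subtraction leaves a nonempty composition).
    After the index shifts of the theorem each sequence satisfies the initial
    conditions and the recurrence of p. *)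

Lemma is_composition_nil m S : is_composition m S [::] = (m == 0).
Proof. by rewrite /is_composition eq_sym. Qed.

Lemma is_composition_cons m S k s :
  is_composition m S (k :: s) =
  [&& 0 < k, k \in S, k <= m & is_composition (m - k) S s].
Proof.
rewrite /is_composition /= -!andbA; case: (all _ s); last by rewrite !andbF.
by congr [&& _, _ & _] => /=; lia.
Qed.

(** Two duplicate-free lists with the same members are permutations of each other, so any such
    enumeration may be used for counting. *)
Lemma count_compositions_size m (S : {pred nat}) (l : seq (seq nat)) :
    uniq l -> (forall s, (s \in l) = is_composition m S s) ->
  count_compositions m S = size l.
Proof.
move=> l_uniq lP; have [l' [l'_uniq l'P <-]] := count_compositionsP m S.
by apply/perm_size/uniq_perm => // s; rewrite lP l'P.
Qed.

Lemma count_compositions0 (S : {pred nat}) : count_compositions 0 S = 1.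
Proof.
apply: (@count_compositions_size _ _ [:: [::]]) => // -[|k s].
  by rewrite is_composition_nil.
by rewrite is_composition_cons; case: k => [|k]; rewrite ?andbF.
Qed.

Lemma count_compositions_first_part m (S : {pred nat}) : 0 < m ->
  count_compositions m S =
  \sum_(1 <= k < m.+1 | k \in S) count_compositions (m - k) S.
Proof.
move=> m_gt0.
(* Choose for each [k] an enumeration [l k] of the compositions of [m - k]; prefixing [k] to its
   members, for all admissible [k], enumerates the compositions of [m]. *)
have [l lP] := fin_all_exists
  (fun k : 'I_m.+1 => count_compositionsP (m - k) S).
pose ks := [seq k : 'I_m.+1 <- enum 'I_m.+1 | (0 < k) && (nat_of_ord k \in S)].
rewrite (@count_compositions_size m S
  [seq nat_of_ord k :: s | k : 'I_m.+1 <- ks, s : seq nat <- l k]).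
- rewrite size_allpairs_dep sumnE big_map big_filter big_enum_cond /=.
  rewrite [RHS](big_nat_widenl _ 0) // big_mkord.
  by apply: eq_big => [k | k _]; [rewrite andbC | have [_ _ ->] := lP k].
- apply: allpairs_uniq_dep => [|k _|].
  + exact/filter_uniq/enum_uniq.
  + by have [] := lP k.
  + by move=> [k s] [k' s'] _ _ /= [/val_inj-> ->].
- move=> s; apply/allpairsPdep/idP => [[k [t [ks_k lt ->]]] | ].
    have [_ ltP _] := lP k; rewrite is_composition_cons -ltP lt.
    move: ks_k; rewrite mem_filter => /andP[/andP[-> ->] _] /=.
    by rewrite andbT -ltnS.
  case: s => [|k s]; first by rewrite is_composition_nil gtn_eqF.
  rewrite is_composition_cons -[k <= m]ltnS => /and4P[k_gt0 Sk le_km Hs].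
  exists (Ordinal le_km), s; have [_ -> _] := lP (Ordinal le_km).
  by rewrite mem_filter mem_enum /= k_gt0 Sk.
Qed.

Lemma sum_nat_eq_op m a (F : nat -> nat) : 0 < a ->
  \sum_(1 <= k < m.+1) (k == a) * F k = if a <= m then F a else 0.
Proof.
move=> a_gt0; case: leqP => [le_am | lt_ma].
  rewrite (bigD1_seq a) ?iota_uniq ?mem_index_iota ?a_gt0 //= eqxx mul1n.
  by rewrite big1 ?addn0 // => k /negPf->.
by rewrite big_nat big1 // => k /andP[_ lt_km]; rewrite ltn_eqF //; lia.
Qed.

Lemma count_compositions_pred2 m a b : 0 < m -> 0 < a -> 0 < b -> a != b ->
  count_compositions m (pred2 a b) =
    (if a <= m then count_compositions (m - a) (pred2 a b) else 0) +
    (if b <= m then count_compositions (m - b) (pred2 a b) else 0).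
Proof.
move=> m_gt0 a_gt0 b_gt0 neq_ab; rewrite count_compositions_first_part //.
set c := fun k => count_compositions (m - k) (pred2 a b).
rewrite -(@sum_nat_eq_op m a c) // -(@sum_nat_eq_op m b c) // -big_split /=.
rewrite big_mkcond; apply: eq_bigr => k _; rewrite -mulnDl inE -/(c k).
by have [->|_] := eqVneq k a; rewrite ?(negPf neq_ab) ?mul1n //; case: eqP;
  rewrite ?mul1n.
Qed.

(* The hypothesis on S says that S is the progression a, a + d, a + 2d, ...;
   writing it as a sum of booleans makes its two cases exclusive. *)
Lemma count_compositions_progression m a d (S : {pred nat}) :
    0 < m -> 0 < a ->
    (forall k, 0 < k -> (k \in S) = (k == a) + ((d < k) && (k - d \in S)) :> nat) ->
  count_compositions m S =
    (if a <= m then count_compositions (m - a) S else 0) +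
    (if d < m then count_compositions (m - d) S else 0).
Proof.
move=> m_gt0 a_gt0 S_prog; rewrite count_compositions_first_part //.
set c := fun k => count_compositions (m - k) S.
have -> : \sum_(1 <= k < m.+1 | k \in S) c k =
    \sum_(1 <= k < m.+1) (k == a) * c k +
    \sum_(1 <= k < m.+1) ((d < k) && (k - d \in S)) * c k.
  rewrite -big_split big_mkcond /=; apply: eq_big_nat => k /andP[k_gt0 _].
  by rewrite -mulnDl -S_prog //; case: (k \in S); rewrite ?mul1n.
rewrite sum_nat_eq_op //; congr (_ + _).
case: ltnP => [lt_dm | le_md]; last first.
  rewrite big_nat big1 // => k /andP[_ lt_km].
  by rewrite (_ : (d < k) = false) //; lia.
(* The terms with [k <= d] vanish; shifting the others by [d] gives the first-part recurrence for
   [m - d]. *)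
rewrite (big_cat_nat (n := d.+1)) //=; last by lia.
rewrite big_nat big1 => [|k /andP[_ lt_kd]]; last first.
  by rewrite (_ : (d < k) = false) //; lia.
rewrite add0n count_compositions_first_part ?subn_gt0 //.
rewrite -[d.+1]add1n big_addn subSn ?(ltnW lt_dm) // [RHS]big_mkcond /=.
apply: eq_big_nat => k /andP[k_gt0 _].
rewrite addnK /c leq_add2r k_gt0 [k + d]addnC subnDA /=.
by case: (k \in S); rewrite ?mul1n.
Qed.

(** Strong induction; [2 <= q] makes [n - q + 1] smaller than [n]. *)
Lemma recurrence_unique q (f g : nat -> nat) : 2 <= q ->
    (forall i, i < q -> f i = g i) ->
    (forall n, f (n + q) = f (n + 1) + f n) ->
    (forall n, g (n + q) = g (n + 1) + g n) ->
  f =1 g.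
Proof.
move=> q_ge2 eq_init f_rec g_rec; elim/ltn_ind => n IHn.
have [/eq_init // | le_qn] := ltnP n q.
by rewrite -(subnK le_qn) f_rec g_rec !IHn //; lia.
Qed.

Theorem theorem7 (q : nat) (p : nat -> nat) (hq : 2 <= q)
    (hp0 : forall i : nat, i <= q - 2 -> p i = 0)
    (hp1 : p (q - 1) = 1)
    (hprec : forall n : nat, p (n + q) = p (n + 1) + p n) :
  [/\ forall n : nat, q <= n ->
        p n = count_compositions (n - q + 1) (pred2 (q - 1) q),
      forall n : nat, 1 <= n ->
        p n = count_compositions n [pred k | k == q - 1 %[mod q]]
    & forall n : nat, 1 <= n ->
        p n = count_compositions (n + 1)
                [pred k | (k == 1 %[mod q - 1]) && (k != 1)]].
Proof.
have p_init i : i < q -> p i = (i == q - 1).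
  by have [-> //|ne_iq lt_iq] := eqVneq i (q - 1); apply: hp0; lia.
split.
- set S := pred2 _ _.
  (* The guard is essential: for [n < q - 1] truncated subtraction would give the value 1 of the
     empty composition instead of 0. *)
  pose f n := if q - 1 <= n then count_compositions (n - (q - 1)) S else 0.
  suff pf : p =1 f.
    move=> n le_qn; rewrite pf /f ifT; last by lia.
    by congr count_compositions; lia.
  apply: (@recurrence_unique q) => // [i lt_iq | n].
    rewrite p_init // /f; case: eqVneq => [->|ne_iq].
      by rewrite leqnn subnn count_compositions0.
    by rewrite ifF //; lia.
  rewrite /f ifT; last by lia.
  rewrite (_ : n + q - (q - 1) = n + 1); last by lia.
  rewrite count_compositions_pred2 -/S; [|lia..].
  congr (_ + _); rewrite (_ : (q <= n + 1) = (q - 1 <= n)); last by lia.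
  by rewrite (_ : n + 1 - q = n - (q - 1)) //; lia.
- set S := [pred k | _].
  have S_prog k : 0 < k ->
      (k \in S) = (k == q - 1) + ((q < k) && (k - q \in S)) :> nat.
    move=> k_gt0; rewrite !inE [(q - 1) %% q]modn_small; last by lia.
    have [lt_qk | lt_kq | <-] := ltngtP q k.
    + rewrite -{1}(subnK (ltnW lt_qk)) modnDr.
      by rewrite (_ : (k == q - 1) = false) //; lia.
    + by rewrite modn_small // addn0.
    + by rewrite modnn; lia.
  (* At 0 the empty composition would count 1, whereas [p 0 = 0]. *)
  pose f n := if 0 < n then count_compositions n S else 0.
  suff pf : p =1 f by move=> n n_gt0; rewrite pf /f n_gt0.
  apply: (@recurrence_unique q) => // [i lt_iq | n].
    rewrite p_init // /f; case: posnP => [-> | i_gt0]; first by rewrite ltn_eqF ?subn_gt0.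
    rewrite (@count_compositions_progression _ _ _ _ _ _ S_prog); [|lia..].
    rewrite (_ : (q < i) = false) ?addn0; last by lia.
    case: eqVneq => [->|ne_iq].
      by rewrite leqnn subnn count_compositions0.
    by rewrite ifF //; lia.
  rewrite /f !addn_gt0 (ltnW hq) !orbT.
  rewrite (@count_compositions_progression _ _ _ _ _ _ S_prog); [|lia..].
  rewrite ifT; last by lia.
  rewrite (_ : n + q - (q - 1) = n + 1); last by lia.
  (* The strict condition [q < n + q] is exactly the guard [0 < n] of [f n]. *)
  by rewrite -[X in X < _]add0n ltn_add2r addnK.
- set S := [pred k | _].
  have S_prog k : 0 < k ->
      (k \in S) = (k == q) + ((q - 1 < k) && (k - (q - 1) \in S)) :> nat.
    move=> k_gt0; rewrite !inE.
    have [lt_dk | lt_kd | k_d] := ltngtP (q - 1) k.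
    + rewrite -{1}(subnK (ltnW lt_dk)) modnDr.
      (* Subtracting [q - 1] reaches the excluded value 1 only from [q], so the progression starts
         at [q]. *)
      have [->|ne_kq] := eqVneq k q.
        by rewrite (_ : q - (q - 1) = 1) ?eqxx ?andbF //; lia.
      by rewrite (_ : (k != 1) = (k - (q - 1) != 1)) //; lia.
    + by rewrite !modn_small; lia.
    + rewrite -k_d modnn (_ : (q - 1 == q) = false); last by lia.
      have [->//|ne_d1] := eqVneq (q - 1) 1.
      by rewrite modn_small //; lia.
  (* Needed for the initial value at [q - 1]: among the compositions of [q], the recurrence leaves
     [c_0 + c_1], which must equal 1. *)
  have c1 : count_compositions 1 S = 0.
    rewrite (@count_compositions_progression _ _ _ _ _ _ S_prog); [|lia..].
    by rewrite !ifF //; lia.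
  pose f n := count_compositions (n + 1) S.
  suff pf : p =1 f by move=> n n_gt0; rewrite pf.
  apply: (@recurrence_unique q) => // [i lt_iq | n].
    rewrite p_init // /f.
    rewrite (@count_compositions_progression _ _ _ _ _ _ S_prog); [|lia..].
    case: eqVneq => [->|ne_iq].
      rewrite !ifT; [|lia..].
      rewrite (_ : q - 1 + 1 - q = 0) ?count_compositions0; last by lia.
      by rewrite (_ : q - 1 + 1 - (q - 1) = 1) ?c1 //; lia.
    by rewrite !ifF //; lia.
  rewrite /f (@count_compositions_progression _ _ _ _ _ _ S_prog); [|lia..].
  rewrite !ifT; [|lia..]; rewrite addnC.
  by congr (count_compositions _ _ + count_compositions _ _); lia.
Qed.
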